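(* Let $a \geq 1$ be a real number. Then: (i) For every $\epsilon > 0$ there exists $k_0 = k_0(a,\epsilon)$ such that for every integer $k \geq k_0$, every $k$-uniform hypergraph $H$ with maximum degree $\Delta(H) \leq k^a$ satisfies $ec(H) \geq (1-\epsilon)\frac{k}{a \ln k}$. In other words, $ec(H) \geq \frac{k}{a\ln k}(1-o_k(1))$, where the $o_k(1)$ term tends to $0$ as $k\to\infty$ (for fixed $a$). (ii) The bound is asymptotically tight: for every $\epsilon>0$ and all sufficiently large $k$, there exists a $k$-uniform hypergraph $H$ with maximum degree at most $k^a$ and $c(H) \leq (1+\epsilon)\frac{k}{a \ln k}$; i.e. there exist $k$-uniform hypergraphs $H$ with $\Delta(H)\le k^a$ and $c(H)\leq \frac{k}{a\ln k}(1+o_k(1))$.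
   Context: All hypergraphs are finite. A hypergraph $H$ is $k$-uniform if every edge is a set of exactly $k$ vertices; $\Delta(H)$ denotes the maximum degree (maximum number of edges containing a single vertex). Let $H$ have $n$ vertices. A strong $r$-coloring of $H$ is a partition of the vertex set into $r$ parts such that every edge of $H$ intersects every part. A strong $r$-coloring is equitable if every part has size $\lceil n/r \rceil$ or $\lfloor n/r \rfloor$. $c(H)$ denotes the maximum number of parts in a strong coloring of $H$, and $ec(H)$ denotes the maximum number of parts in an equitable strong coloring of $H$ (so $1 \le ec(H) \le c(H) \le k$). $\ln$ is the natural logarithm. *)

(* Defs.v *)
(* MathComp / MathComp-Analysis. *)
From mathcomp Require Import all_boot.

Set Implicit Arguments.
Unset Strict Implicit.
Unset Printing Implicit Defensive.

(* A hypergraph on the finite vertex type V is given by its set of edges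
   E : {set {set V}}. *)

Definition uniform (V : finType) (k : nat) (E : {set {set V}}) : bool :=
  [forall e in E, #|e| == k].

Definition degree (V : finType) (E : {set {set V}}) (v : V) : nat :=
  #|[set e in E | v \in e]|.

Definition max_degree (V : finType) (E : {set {set V}}) : nat :=
  \max_(v : V) degree E v.

(* A strong r-coloring is a P with [strong_coloring E P] and #|P| = r; the
   library's [partition] requires parts to be nonempty, which is automatic as
   soon as E has an edge. *)
Definition strong_coloring (V : finType) (E P : {set {set V}}) : bool :=
  partition P [set: V] && [forall e in E, forall p in P, e :&: p != set0].

Definition ceil_divn (n r : nat) : nat := (n + r.-1) %/ r.

Definition equitable (V : finType) (P : {set {set V}}) : bool :=
  [forall p in P, (#|p| == ceil_divn #|V| #|P|) || (#|p| == #|V| %/ #|P|)].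

(* For a k-uniform E with k > 0 and at least one edge, the one-part partition
   is an equitable strong coloring and every strong coloring has at most k
   parts. The bound by k needs an edge: if E is empty, both numbers below
   equal #|V|. *)
Definition strong_coloring_number (V : finType) (E : {set {set V}}) : nat :=
  \max_(P : {set {set V}} | strong_coloring E P) #|P|.

Definition equitable_coloring_number (V : finType) (E : {set {set V}}) : nat :=
  \max_(P : {set {set V}} | strong_coloring E P && equitable P) #|P|.

(* Main.v *)
(* Part (i): put L = ln k. The local lemma applied directly has dependency degree
   about k^(a+1), which costs a factor in the number of colors. So it is applied
   twice. First V is split into about k/L^2 parts such that every edge meets every
   part in at least m vertices, m close to L^2; the failure probability is
   superpolynomially small, so any polynomial dependency degree is harmless. Then
   each part is colored separately, using only m vertices of each edge: the
   dependency degree drops to k^(a+o(1)) and about m/(a L) colors are affordable.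
   Both random colorings are exactly equitable: the vertices are cut into blocks
   of size t (the number of colors) and each block is colored by a random cyclic
   shift. An equitable splitting of an equitable splitting is equitable.

   Part (ii): take k^2 vertices and add edges greedily, each inside the set of
   vertices whose degree is still below k^a and each avoiding at least a fraction
   p = k^(-(1-d/2)a) of the tau-subsets not yet avoided, tau ~ (1-d) a k ln k.
   About k^(a+1) steps are possible before the saturated vertices matter, and this
   suffices to avoid every tau-subset; so every color class has more than tau
   vertices. *)

Require Import Defs.
From mathcomp Require Import all_boot all_order all_algebra.
From mathcomp Require Import reals sequences exp.
From mathcomp Require Import zify ring lra.
Import Order.TTheory GRing.Theory Num.Theory.

Set Implicit Arguments.
Unset Strict Implicit.
Unset Printing Implicit Defensive.

(** * The local lemma and independence, by counting points *)

Definition avoid (Om I : finType) (A : I -> {set Om}) (S : {set I}) : {set Om} :=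
  [set x | [forall i in S, x \notin A i]].

Lemma avoidU1 (Om I : finType) (A : I -> {set Om}) (i : I) (S : {set I}) :
  avoid A (i |: S) = avoid A S :\: A i.
Proof.
apply/setP => x; rewrite !inE; apply/forall_inP/andP.
  move=> h; split; first by apply: h; rewrite !inE eqxx.
  by apply/forall_inP => j jS; apply: h; rewrite !inE jS orbT.
case=> xi /forall_inP h j; rewrite !inE => /orP[/eqP->//|]; exact: h.
Qed.

Lemma avoidS (Om I : finType) (A : I -> {set Om}) (S T : {set I}) :
  S \subset T -> avoid A T \subset avoid A S.
Proof.
move=> sST; apply/subsetP => x; rewrite !inE => /forall_inP h.
by apply/forall_inP => j jS; apply: h; apply: (subsetP sST).
Qed.

Lemma card_bigcup_le (T I : finType) (P : pred I) (F : I -> {set T}) :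
  #|\bigcup_(i | P i) F i| <= \sum_(i | P i) #|F i|.
Proof.
elim/big_rec2: _ => [|i u v _ h]; first by rewrite cards0.
by apply: leq_trans (leq_card_setU _ _) _; rewrite leq_add2l.
Qed.

(* The Lovasz local lemma for counting measure, each event having conditional
   probability at most 1/M; 4 d <= M replaces the usual e (d + 1) <= M. *)
Lemma local_lemma_step (Om I : finType) (A : I -> {set Om}) (G : I -> {set I})
    (d M : nat) :
  (forall i, #|G i| <= d) -> 0 < M -> 4 * d <= M ->
  (forall i (S : {set I}), [disjoint G i & S] ->
     #|A i :&: avoid A S| * M <= #|avoid A S|) ->
  forall (S : {set I}) i, #|A i :&: avoid A S| * M <= 2 * #|avoid A S|.
Proof.
move=> Gd M0 dM indep S; have [n] := ubnP #|S|.
elim: n S => // n IHn S ltSn i.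
set S1 := S :&: G i; set S2 := S :\: G i.
have indep2 : #|A i :&: avoid A S2| * M <= #|avoid A S2|.
  by apply: indep; rewrite disjoint_sym disjoints_subset /S2 setDE subsetIr.
have le1 : #|A i :&: avoid A S| <= #|A i :&: avoid A S2|.
  by rewrite subset_leq_card // setIS // avoidS // subsetDl.
(* If no event of [S] is a neighbour of [i], then [S2] is [S] itself: the induction hypothesis
   cannot be applied to it, but [indep2] already suffices. *)
have [S1_0|S1_n0] := eqVneq S1 set0.
  have SE : S = S2 by rewrite -(setID S (G i)) -/S1 S1_0 set0U.
  by rewrite {1}SE; apply: (leq_trans indep2); rewrite -SE leq_pmull.
have ltS2 : #|S2| < n.
  rewrite -ltnS (leq_trans _ ltSn) // ltnS.
  by rewrite -(cardsID (G i) S) -[X in X < _]add0n ltn_add2r card_gt0.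
(* Union bound: a point that avoids [S2] but not [S] lies in [A j] for some neighbour [j] in
   [S1]. *)
have lb : #|avoid A S2| <= #|avoid A S| + \sum_(j in S1) #|A j :&: avoid A S2|.
  have sub : avoid A S2 \subset
      avoid A S :|: \bigcup_(j in S1) (A j :&: avoid A S2).
    apply/subsetP => x xS2; rewrite inE.
    case: (boolP (x \in avoid A S)) => //= nx; apply/bigcupP.
    move: nx; rewrite inE negb_forall => /existsP[j].
    rewrite negb_imply negbK => /andP[jS xj].
    exists j; last by rewrite inE xj.
    rewrite inE jS /=; apply: contraTT xS2 => njG.
    rewrite inE negb_forall; apply/existsP; exists j.
    by rewrite negb_imply negbK xj inE njG jS.
  apply: (leq_trans (subset_leq_card sub)).
  apply: (leq_trans (leq_card_setU _ _)); rewrite leq_add2l.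
  exact: card_bigcup_le.
have ub : (\sum_(j in S1) #|A j :&: avoid A S2|) * M <= d * (2 * #|avoid A S2|).
  rewrite big_distrl /=.
  apply: (@leq_trans (\sum_(j in S1) 2 * #|avoid A S2|)).
    by apply: leq_sum => j _; apply: IHn.
  rewrite sum_nat_const leq_mul2r; apply/orP; right.
  by rewrite (leq_trans _ (Gd i)) // subset_leq_card // subsetIr.
(* By [ub] the neighbours cover at most a fraction [2 * d / M <= 1/2] of [avoid A S2], which is the
   source of the factor 2 in the conclusion. *)
have half : #|avoid A S2| <= 2 * #|avoid A S|.
  rewrite -(leq_pmul2r M0); move: lb ub dM M0.
  move: (\sum_(j in _) _) (#|avoid A S2|) (#|avoid A S|) => s u v; nia.
by apply: leq_trans half; apply: leq_trans indep2; rewrite leq_mul2r le1 orbT.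
Qed.

(** Excluding the events one at a time, each exclusion removes at most a fraction [2 / M < 1] of the
    points still left, so some point survives them all. *)
Lemma local_lemma (Om I : finType) (A : I -> {set Om}) (G : I -> {set I})
    (d M : nat) :
  0 < #|Om| -> (forall i, #|G i| <= d) -> 4 * d <= M -> 2 < M ->
  (forall i (S : {set I}), [disjoint G i & S] ->
     #|A i :&: avoid A S| * M <= #|avoid A S|) ->
  exists x, forall i, x \notin A i.
Proof.
move=> Om0 Gd dM M2 indep.
have pos (S : {set I}) : 0 < #|avoid A S|.
  have [n] := ubnP #|S|; elim: n S => // n IHn S.
  have [->|[i iS]] := set_0Vmem S.
    move=> _; rewrite (_ : avoid A set0 = setT) ?cardsT //.
    by apply/setP => x; rewrite !inE; apply/forall_inP => i; rewrite inE.
  rewrite ltnS => leSn; rewrite -(setD1K iS) avoidU1.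
  have := IHn (S :\ i); rewrite (leq_trans _ leSn); last first.
    by rewrite (cardsD1 i S) iS.
  move=> /(_ isT) pos1.
  have M0 : 0 < M by lia.
  have := local_lemma_step Gd M0 dM indep (S :\ i) i.
  have := cardsID (A i) (avoid A (S :\ i)); rewrite [_ :&: A i]setIC.
  move: pos1 M2; move: #|A i :&: _| #|_ :\: A i| #|avoid A _| => u v w; nia.
case/card_gt0P: (pos setT) => x; rewrite inE => /forall_inP h.
by exists x => i; apply: h; rewrite inE.
Qed.

(* Swapping the X-coordinates of two points of the product space is an
   involution exchanging [(C :&: N) * Om] and [C * N]. *)
Lemma card_indep (B T : finType) (X : {set B}) (C N : {set {ffun B -> T}}) :
  (forall f g : {ffun B -> T}, {in X, f =1 g} -> (f \in C) = (g \in C)) ->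
  (forall f g : {ffun B -> T}, {in ~: X, f =1 g} -> (f \in N) = (g \in N)) ->
  #|C :&: N| * #|{ffun B -> T}| = #|C| * #|N|.
Proof.
move=> hC hN.
pose mix (f g : {ffun B -> T}) : {ffun B -> T} :=
  [ffun b => if b \in X then f b else g b].
pose sw (u : {ffun B -> T} * {ffun B -> T}) := (mix u.1 u.2, mix u.2 u.1).
have swK : involutive sw.
  move=> [f g]; rewrite /sw /=.
  by congr pair; apply/ffunP => b; rewrite !ffunE; case: (b \in X).
have <- : #|setX (C :&: N) [set: {ffun B -> T}]| = #|C :&: N| * #|{ffun B -> T}|.
  by rewrite cardsX cardsT.
rewrite -cardsX -(card_imset _ (inv_inj swK)); apply: eq_card => -[f g].
have mC (f' g' : {ffun B -> T}) : (mix f' g' \in C) = (f' \in C).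
  by apply: hC => b bX; rewrite ffunE bX.
have mN (f' g' : {ffun B -> T}) : (mix f' g' \in N) = (g' \in N).
  by apply: hN => b; rewrite inE ffunE => /negbTE->.
apply/imsetP/idP => [[[f' g']]|].
  by rewrite !inE /= => h [-> ->]; rewrite mC mN andbT in h *.
rewrite inE /= => h; exists (sw (f, g)); last by rewrite swK.
by rewrite !inE /= mC mN h.
Qed.

Local Open Scope ring_scope.

(** * Random cyclic shifts of blocks *)

(** The palette is the cyclic group on ['I_t.+1], and the sample point [x] picks one independent
    rotation per block. *)
Definition shift_col (V B : finType) (t : nat) (blk : V -> B) (pos : V -> 'I_t.+1)
  (x : {ffun B -> 'I_t.+1}) (v : V) : 'I_t.+1 := pos v + x (blk v).

Definition hits (V : finType) (C : eqType) (S : {set V}) (col : V -> C) (c : C) : nat :=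
  #|[set v in S | col v == c]|.

(* Chernoff bound with an explicit parameter z; z = 0 and y = 1 bounds the
   probability that S misses the color c, since 0 ^+ 0 = 1. *)
Lemma shift_tail (R : realType) (V B : finType) (t : nat) (blk : V -> B)
    (pos : V -> 'I_t.+1) (S : {set V}) (c : 'I_t.+1) (y : nat) (z : R) :
  {in S &, injective (fun v => (blk v, pos v))} ->
  0 <= z -> z <= 1 -> (0 < y)%N ->
  #|[set x | (hits S (shift_col blk pos x) c < y)%N]|%:R * z ^+ y.-1
    <= #|{ffun B -> 'I_t.+1}|%:R * expR (- (#|S|%:R / t.+1%:R * (1 - z))).
Proof.
move=> inj z0 z1 y0.
pose N b (u : 'I_t.+1) := #|[set v in S | (blk v == b) && (pos v + u == c)]|.
pose p b := #|[set v in S | blk v == b]|.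
have T0 : 0 < t.+1%:R :> R by rewrite ltr0n.
(* Vertices of [S] in one block have distinct positions, so one shift gives the color [c] to at most
   one of them. *)
have N1 b u : (N b u <= 1)%N.
  apply/card_le1_eqP => v w; rewrite !inE => /and3P[vS /eqP vb /eqP vc].
  move=> /and3P[wS /eqP wb /eqP wc]; apply: inj => //; rewrite vb wb.
  by congr pair; apply: (addIr u); rewrite vc wc.
have sumN b : (\sum_u N b u = p b)%N.
  rewrite /p -sum1_card (eq_bigr (fun u => \sum_(v in S | blk v == b)
    ((pos v + u)%R == c : nat))%N); last first.
    move=> u _; rewrite /N -sum1_card [RHS]big_mkcond [LHS]big_mkcond /=.
    apply: eq_bigr => v _; rewrite inE.
    by case: (v \in S); case: (blk v == b); case: (pos v + u == c).
  rewrite exchange_big /=; apply: eq_big => [v|v _]; first by rewrite inE.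
  rewrite (bigD1 (c - pos v)) //= addrC subrK eqxx big1 // => u /negP uc.
  apply/eqP; rewrite eqb0; apply/negP => /eqP e.
  by apply: uc; rewrite -e addrAC subrr add0r.
(* As [N b u] is 0 or 1, [z ^+ N b u] is affine in it; over all shifts the [N b u] add up to [p b],
   and [1 + x <= expR x] finishes. *)
have sumb b : \sum_u z ^+ N b u
    <= t.+1%:R * expR (- ((p b)%:R / t.+1%:R * (1 - z))).
  rewrite (eq_bigr (fun u => 1 - (1 - z) * (N b u)%:R)); last first.
    move=> u _; have := N1 b u; case: (N b u) => [|[|]] // _.
      by rewrite mulr0 subr0.
    by rewrite mulr1 expr1 opprB addrC subrK.
  rewrite sumrB -mulr_sumr -natr_sum sumN sumr_const card_ord.
  apply: le_trans (ler_wpM2l (ltW T0) (expR_ge1Dx _)).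
  rewrite mulrDr mulr1 mulrN mulrA mulrCA divff ?gt_eqF // mulr1.
  by rewrite [_ * (1 - z)]mulrC.
have hitsE x : hits S (shift_col blk pos x) c = (\sum_b N b (x b))%N.
  rewrite /hits -sum1_card (partition_big blk xpredT) //=.
  apply: eq_bigr => b _; rewrite /N -sum1_card; apply: eq_bigl => v.
  rewrite !inE /shift_col -andbA; congr andb.
  by rewrite andbC; case: eqP => // ->.
(* Markov's inequality: since [z <= 1], each bad [x] contributes at least [z ^+ y.-1] to the sum. *)
apply: (@le_trans _ _ (\sum_(x : {ffun B -> 'I_t.+1}) \prod_b z ^+ N b (x b))).
  rewrite mulr_natl -sumr_const.
  rewrite [leRHS](bigID [in [set x | (hits S (shift_col blk pos x) c < y)%N]]) /=.
  rewrite -[leLHS]addr0 lerD //; last first.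
    by apply: sumr_ge0 => x _; apply: prodr_ge0 => b _; apply: exprn_ge0.
  apply: ler_sum => x; rewrite inE hitsE => xy.
  rewrite -expr_sum; apply: ler_wiXn2l => //.
  by rewrite -ltnS prednK.
(* Independence of the shifts: the sum over all [x] factors over the blocks. *)
rewrite -(bigA_distr_bigA (fun b u => z ^+ N b u)) /=.
apply: (@le_trans _ _ (\prod_b (t.+1%:R * expR (- ((p b)%:R / t.+1%:R * (1 - z)))))).
  apply: ler_prod => b _; rewrite sumb andbT.
  by apply: sumr_ge0 => u _; apply: exprn_ge0.
rewrite big_split /= prodr_const card_ffun card_ord natrX -expR_sum sumrN.
rewrite -mulr_suml -mulr_suml -natr_sum ler_wpM2l ?exprn_ge0 ?ler0n //.
rewrite ler_expR lerN2 ler_wpM2r ?subr_ge0 // ler_wpM2r ?invr_ge0 ?ler0n //.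
rewrite ler_nat -[#|S|]sum1_card (partition_big blk xpredT) //=.
apply: leq_sum => b _; rewrite sum1_card /p; apply: subset_leq_card.
by apply/subsetP => v; rewrite !inE.
Qed.

(** The bad events are the pairs of a set [S j] and a color, and two of them are neighbours when
    their sets meet a common block. A set meets at most [m] blocks, a block has at most [t.+1]
    vertices of [U], each of these lies in at most [D] sets, and there are [t.+1] colors. The last
    hypothesis is the local lemma condition with [M] equal to four times this degree. *)
Lemma shift_local_lemma (R : realType) (V B J : finType) (t m y D : nat)
    (blk : V -> B) (pos : V -> 'I_t.+1) (U : {set V}) (S : J -> {set V}) (z : R) :
  {in U &, injective (fun v => (blk v, pos v))} ->
  (forall j, S j \subset U) -> (forall j, #|S j| = m) ->
  (forall v, (#|[set j | v \in S j]| <= D)%N) ->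
  (0 < m)%N -> (0 < D)%N -> (0 < y)%N -> 0 <= z -> z <= 1 -> 0 < z ^+ y.-1 ->
  (4 * (m * t.+1 * t.+1 * D))%:R * expR (- (m%:R / t.+1%:R * (1 - z)))
    <= z ^+ y.-1 ->
  exists x, forall j c, (y <= hits (S j) (shift_col blk pos x) c)%N.
Proof.
move=> inj SU Sm SD m0 D0 y0 z0 z1 zy0 bound.
set M := (4 * _)%N in bound.
pose A (i : J * 'I_t.+1) := [set x | (hits (S i.1) (shift_col blk pos x) i.2 < y)%N].
pose G (i : J * 'I_t.+1) := [set i' : J * 'I_t.+1 |
  [exists v in S i.1, exists v' in S i'.1, blk v' == blk v]].
have M4 : (4 <= M)%N by rewrite /M leq_pmulr // !muln_gt0 m0 D0.
have [| | | | |x hx] := @local_lemma _ _ A G (m * t.+1 * t.+1 * D) M.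
- by rewrite card_ffun card_ord expn_gt0.
- move=> [j c].
  have sub : G (j, c) \subset \bigcup_(v in S j)
      \bigcup_(v' in [set v' in U | blk v' == blk v])
      setX [set j' | v' \in S j'] [set: 'I_t.+1].
    apply/subsetP => -[j' c']; rewrite inE => /exists_inP[v vS /exists_inP[v' v'S e]].
    apply/bigcupP; exists v => //; apply/bigcupP; exists v'.
      by rewrite inE (subsetP (SU j')).
    by rewrite !inE /= v'S.
  apply: leq_trans (subset_leq_card sub) _.
  apply: leq_trans (card_bigcup_le _ _) _.
  rewrite -(Sm j) -!mulnA -sum_nat_const; apply: leq_sum => v _.
  apply: leq_trans (card_bigcup_le _ _) _.
  apply: (@leq_trans (\sum_(v' in [set v' in U | blk v' == blk v]) (t.+1 * D))).
    by apply: leq_sum => v' _; rewrite cardsX cardsT card_ord mulnC leq_mul2l SD orbT.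
  rewrite sum_nat_const leq_mul2r; apply/orP; right.
  rewrite -[X in (_ <= X)%N]card_ord -(card_in_imset (f := pos)) ?max_card //.
  move=> v1 v2; rewrite !inE => /andP[v1U /eqP e1] /andP[v2U /eqP e2] e.
  by apply: inj => //; rewrite e1 e2 e.
- by [].
- exact: leq_trans M4.
- move=> [j c] T disj.
  have indep := @card_indep _ _ (blk @: S j) (A (j, c)) (avoid A T).
  have Om0 : (0 < #|{ffun B -> 'I_t.+1}|)%N by rewrite card_ffun card_ord expn_gt0.
  have small : (#|A (j, c)| * M <= #|{ffun B -> 'I_t.+1}|)%N.
    have injS : {in S j &, injective (fun v => (blk v, pos v))}.
      by move=> v w vS wS; apply: inj; apply: (subsetP (SU j)).
    have := shift_tail c injS z0 z1 y0; rewrite Sm => tail.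
    rewrite -(ler_nat R) natrM -(ler_pM2r zy0) mulrAC.
    apply: le_trans (ler_wpM2r (ler0n _ _) tail) _.
    by rewrite -[leLHS]mulrA ler_wpM2l ?ler0n // mulrC.
  have hitsE i (f g : {ffun B -> 'I_t.+1}) :
      {in blk @: S i.1, f =1 g} -> (f \in A i) = (g \in A i).
    move=> fg; rewrite !inE; congr (_ < _)%N; apply: eq_card => v; rewrite !inE.
    by case vS: (v \in S i.1) => //=; rewrite /shift_col fg // imset_f.
  (* The event reads only the shifts of blocks meeting [S j], while [avoid A T] reads only the other
     shifts, so conditioning leaves its probability unchanged. *)
  rewrite -(leq_pmul2r Om0) mulnAC indep.
  + by rewrite mulnAC mulnC leq_mul2l small orbT.
  + exact: (hitsE (j, c)).
  + move=> f g fg; rewrite !inE; apply: eq_forallb => i.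
    case iT: (i \in T) => //=; congr negb; apply: hitsE => b /imsetP[v' v'S ->].
    apply: fg; rewrite inE; apply/negP => /imsetP[v vS e].
    move: disj; rewrite disjoint_sym => /disjointFr /(_ iT) /negP; apply.
    rewrite inE; apply/exists_inP; exists v => //; apply/exists_inP; exists v' => //.
    by rewrite e.
by exists x => j c; move: (hx (j, c)); rewrite inE -leqNgt.
Qed.

(** Cut an enumeration of [U] into intervals of length [t.+1]. Under every shift a full block
    contains each color exactly once and the incomplete last block at most once, so the balance of
    the classes holds surely, not just with positive probability. *)
Lemma exists_blocks (V : finType) (U : {set V}) (t : nat) :
  exists (B : finType) (blk : V -> B) (pos : V -> 'I_t.+1),
    {in U &, injective (fun v => (blk v, pos v))} /\
    forall x c, (#|U| %/ t.+1 <= hits U (shift_col blk pos x) c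
                  <= ceil_divn #|U| t.+1)%N.
Proof.
pose idx v := index v (enum U).
have ltidx v : v \in U -> (idx v < #|U|)%N by rewrite cardE index_mem mem_enum.
pose blk v : 'I_#|U|.+1 := inord (idx v %/ t.+1).
pose pos v : 'I_t.+1 := inord (idx v %% t.+1).
have blkE v : blk v = (idx v %/ t.+1)%N :> nat.
  rewrite inordK // ltnS (leq_trans (leq_div _ _)) // cardE; exact: index_size.
have posE v : pos v = (idx v %% t.+1)%N :> nat by rewrite inordK // ltn_pmod.
have inj : {in U &, injective (fun v => (blk v, pos v))}.
  move=> v w vU wU [eb ep]; move/(congr1 val): eb; move/(congr1 val): ep.
  rewrite /= !blkE !posE => ep eb.
  have e : idx v = idx w by rewrite (divn_eq (idx v) t.+1) eb ep -divn_eq.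
  by rewrite -(nth_index v (s := enum U) (x := v)) ?mem_enum // -/(idx v) e nth_index ?mem_enum.
exists 'I_#|U|.+1, blk, pos; split => // x c; apply/andP; split.
  case: (posnP (#|U| %/ t.+1)) => [-> //|q0].
  have [v0 _] : exists v0, v0 \in U.
    by apply/card_gt0P; apply: leq_trans q0 (leq_div _ _).
  (* The index in the enumeration of the vertex of the full block [b] that gets color [c]. *)
  pose k b := (b * t.+1 + (c - x (inord b) : 'I_t.+1)%R)%N.
  have kU b : (b < #|U| %/ t.+1)%N -> (k b < #|U|)%N.
    move=> bq; apply: (@leq_trans (b.+1 * t.+1)).
      by rewrite /k mulSn addnC ltn_add2r.
    by apply: leq_trans (leq_trunc_div #|U| t.+1); rewrite leq_mul2r bq orbT.
  have idxk b : (b < #|U| %/ t.+1)%N -> idx (nth v0 (enum U) (k b)) = k b.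
    by move=> bq; rewrite /idx index_uniq ?enum_uniq // -cardE kU.
  pose s := [seq nth v0 (enum U) (k b) | b <- iota 0 (#|U| %/ t.+1)].
  rewrite -[X in (X <= _)%N](size_iota 0) -(size_map (fun b => nth v0 (enum U) (k b))).
  rewrite /hits [leqRHS]cardE; apply: uniq_leq_size => [|v /mapP[b]].
    rewrite map_inj_in_uniq ?iota_uniq // => b b'.
    rewrite !mem_iota /= !add0n => bq b'q /(congr1 idx); rewrite !idxk //.
    move/(congr1 (divn^~ t.+1)).
    by rewrite /k !divnMDl // !divn_small // !addn0.
  rewrite mem_iota /= add0n => bq ->; rewrite mem_enum inE -mem_enum.
  rewrite mem_nth -?cardE ?kU //=; apply/eqP; rewrite /shift_col.
  have -> : blk (nth v0 (enum U) (k b)) = inord b.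
    by rewrite /blk idxk // /k divnMDl // divn_small // addn0.
  have -> : pos (nth v0 (enum U) (k b)) = c - x (inord b).
    by apply: ord_inj; rewrite posE idxk // /k modnMDl modn_small.
  by rewrite subrK.
(* Upper bound: vertices of color [c] lie in distinct blocks, and the number of blocks is the
   ceiling. *)
rewrite /hits [leqLHS]cardE -(size_map (fun v => idx v %/ t.+1)%N) -[leqRHS](size_iota 0).
apply: uniq_leq_size => [|b /mapP[v]].
  rewrite map_inj_in_uniq ?enum_uniq // => v w; rewrite !mem_enum !inE.
  move=> /andP[vU /eqP vc] /andP[wU /eqP wc] e.
  have eb : blk v = blk w by apply: ord_inj; rewrite !blkE.
  apply: inj => //; congr pair => //.
  by move: vc; rewrite -wc /shift_col eb => /addIr.
rewrite mem_enum inE => /andP[vU _] ->; rewrite mem_iota /= add0n /ceil_divn /=.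
have -> : ((idx v %/ t.+1).+1 = (idx v + t.+1) %/ t.+1)%N.
  by rewrite -[X in (_ + X)%N]mul1n divnDMl // addn1.
by apply: leq_div2r; rewrite addnS -addSn leq_add2r; apply: ltidx.
Qed.

(** Every shift is balanced, so the one supplied by the local lemma is too. The first splitting
    takes [y = m]; the second takes [y = 1] and [z = 0]. *)
Lemma equitable_split (R : realType) (V J : finType) (t m y D : nat)
    (U : {set V}) (S : J -> {set V}) (z : R) :
  (forall j, S j \subset U) -> (forall j, #|S j| = m) ->
  (forall v, (#|[set j | v \in S j]| <= D)%N) ->
  (0 < m)%N -> (0 < D)%N -> (0 < y)%N -> 0 <= z -> z <= 1 -> 0 < z ^+ y.-1 ->
  (4 * (m * t.+1 * t.+1 * D))%:R * expR (- (m%:R / t.+1%:R * (1 - z)))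
    <= z ^+ y.-1 ->
  exists col : {ffun V -> 'I_t.+1},
    (forall c, (#|U| %/ t.+1 <= hits U col c <= ceil_divn #|U| t.+1)%N) /\
    (forall j c, (y <= hits (S j) col c)%N).
Proof.
move=> SU Sm SD m0 D0 y0 z0 z1 zy0 bound.
have [B [blk [pos [inj size_class]]]] := exists_blocks U t.
have [x hx] := shift_local_lemma inj SU Sm SD m0 D0 y0 z0 z1 zy0 bound.
have hE T c : hits T [ffun v => shift_col blk pos x v] c
            = hits T (shift_col blk pos x) c.
  by apply: eq_card => v; rewrite !inE ffunE.
by exists [ffun v => shift_col blk pos x v]; split => *; rewrite hE.
Qed.

(** * Rounding and the two-stage equitable coloring *)

(** Ceilings compose as floors do, which is why an equitable splitting of an equitable splitting is
    equitable. *)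
Lemma ceil_divnM (n s t : nat) :
  ceil_divn (ceil_divn n s.+1) t.+1 = ceil_divn n (s.+1 * t.+1).
Proof.
rewrite /ceil_divn /= -divnDMl // -divnMA; congr (_ %/ _)%N; lia.
Qed.

Lemma ceil_divn_le (n r : nat) : (0 < r)%N -> (ceil_divn n r <= (n %/ r).+1)%N.
Proof.
move=> r0; rewrite -addn1 -[X in (_ <= X)%N](divnDMl _ _ r0) mul1n.
by apply: leq_div2r; rewrite leq_add2l leq_pred.
Qed.

Lemma leq_ceil_divn (n n' r : nat) :
  (n <= n')%N -> (ceil_divn n r <= ceil_divn n' r)%N.
Proof. by move=> h; apply: leq_div2r; rewrite leq_add2r. Qed.

Lemma equitable_coloring_number_ge (V : finType) (E P : {set {set V}}) :
  strong_coloring E P -> equitable P -> (#|P| <= equitable_coloring_number E)%N.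
Proof.
move=> sP eP; rewrite /equitable_coloring_number.
by apply: (@leq_bigmax_cond _ _ (fun Q : {set {set V}} => #|Q|)); rewrite sP.
Qed.

(** An edge sees all colors, so the classes are nonempty and distinct; this is where a nonempty [E]
    fixes the number of parts. *)
Lemma equitable_of_map (V : finType) (E : {set {set V}}) (s t : nat)
    (col : V -> 'I_s.+1 * 'I_t.+1) :
  E != set0 ->
  (forall e c, e \in E -> exists2 v, v \in e & col v = c) ->
  (forall c, #|V| %/ (s.+1 * t.+1) <= #|[set v | col v == c]|
               <= ceil_divn #|V| (s.+1 * t.+1))%N ->
  (s.+1 * t.+1 <= equitable_coloring_number E)%N.
Proof.
move=> /set0Pn[e0 e0E] surj size_class.
pose cl c := [set v | col v == c].
pose P := [set cl c | c : 'I_s.+1 * 'I_t.+1].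
have cl_inj : injective cl.
  move=> c c' ecl; have [v _ vc] := surj e0 c e0E.
  have : v \in cl c by rewrite inE vc.
  by rewrite ecl inE vc => /eqP.
have cardP : #|P| = (s.+1 * t.+1)%N by rewrite card_imset // card_prod !card_ord.
rewrite -cardP; apply: equitable_coloring_number_ge.
  apply/andP; split; last first.
    apply/forall_inP => e eE; apply/forall_inP => p /imsetP[c _ ->].
    have [v ve vc] := surj e c eE.
    by apply/set0Pn; exists v; rewrite !inE ve vc eqxx.
  apply/and3P; split.
  - rewrite eqEsubset subsetT /=; apply/subsetP => v _; apply/bigcupP.
    by exists (cl (col v)); rewrite ?inE // imset_f.
  - apply/trivIsetP => p q /imsetP[c _ ->] /imsetP[c' _ ->] ne.
    rewrite -setI_eq0; apply: contraNT ne => /set0Pn[v].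
    by rewrite !inE => /andP[/eqP <- /eqP <-].
  - apply/negP => /imsetP[c _ e]; have [v _ vc] := surj e0 c e0E.
    by have := in_set0 v; rewrite e inE vc eqxx.
apply/forall_inP => p /imsetP[c _ ->]; rewrite cardP.
have /andP[lo hi] := size_class c.
(* Floor and ceiling differ by at most one, so a size between them equals one of them. *)
have := ceil_divn_le #|V| (isT : 0 < s.+1 * t.+1)%N.
move: lo hi; rewrite -/(cl c); move: #|cl c| (ceil_divn _ _) (_ %/ _)%N => x y w.
move=> lo hi le; apply/orP; lia.
Qed.

(** The two numerical hypotheses are the local lemma conditions of the two stages: [s.+1] parts each
    meeting every edge at least [m] times, then [t.+1] colors inside each part. *)
Lemma equitable_lower_bound (R : realType) (V : finType) (E : {set {set V}})
    (k s t m : nat) (z : R) :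
  E != set0 -> uniform k E -> (0 < k)%N -> (0 < m)%N -> 0 < z -> z <= 1 ->
  (4 * (k * s.+1 * s.+1 * max_degree E))%:R
    * expR (- (k%:R / s.+1%:R * (1 - z))) <= z ^+ m.-1 ->
  (4 * (m * t.+1 * t.+1 * max_degree E))%:R * expR (- (m%:R / t.+1%:R)) <= 1 :> R ->
  (s.+1 * t.+1 <= equitable_coloring_number E)%N.
Proof.
move=> En0 /forall_inP unif k0 m0 z0 z1 bound1 bound2.
pose J := {e : {set V} | e \in E}.
have degJ v (F : J -> {set V}) : (forall j, F j \subset val j) ->
    (#|[set j | v \in F j]| <= max_degree E)%N.
  move=> sF; apply: leq_trans (leq_bigmax v).
  rewrite -(card_imset _ val_inj); apply: subset_leq_card.
  apply/subsetP => e /imsetP[j]; rewrite !inE => vj ->.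
  by rewrite (valP j) (subsetP (sF j)).
have D0 : (0 < max_degree E)%N.
  have [e eE] := set0Pn _ En0; have /eqP ke := unif e eE.
  have [v ve] : exists v, v \in e by apply/card_gt0P; rewrite ke.
  apply: leq_trans (leq_bigmax v); apply/card_gt0P; exists e.
  by rewrite inE eE.
have [||||col1 [size1 hit1]] := @equitable_split R V J s k m (max_degree E)
    [set: V] (fun j => val j) z _ _ _ k0 D0 m0 (ltW z0) z1 _ bound1.
- by [].
- by move=> j; apply/eqP/unif/(valP j).
- by move=> v; apply: degJ.
- exact: exprn_gt0.
have stage2 c : exists col2 : {ffun V -> 'I_t.+1},
    (forall c', #|[set v | col1 v == c]| %/ t.+1
       <= hits [set v | col1 v == c] col2 c'
       <= ceil_divn #|[set v | col1 v == c]| t.+1)%N /\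
    (forall (j : J) c', exists2 v, v \in val j & col1 v = c /\ col2 v = c').
  (* Keeping exactly [m] vertices of each edge inside the part makes the second dependency degree
     proportional to [m] instead of [k]. *)
  pose F (j : J) := [set v in take m (enum [set v in val j | col1 v == c])].
  have FP j v : v \in F j -> v \in val j /\ col1 v = c.
    by rewrite inE => /mem_take; rewrite mem_enum inE => /andP[-> /eqP].
  have [|||||col2 [size2 hit2]] := @equitable_split R V J t m 1 (max_degree E)
    [set v | col1 v == c] F 0 _ _ _ m0 D0 isT (lexx 0) ler01 _ _.
  - by move=> j; apply/subsetP => v /FP[_ vc]; rewrite inE vc.
  - move=> j; rewrite /F cardsE (card_uniqP _) ?take_uniq ?enum_uniq //.
    by rewrite size_takel // -cardE hit1.
  - by move=> v; apply: degJ => j; apply/subsetP => w /FP[].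
  - by rewrite expr0.
  - by rewrite subr0 mulr1 expr0.
  exists col2; split => // j c'.
  have /card_gt0P[v] := hit2 j c'; rewrite inE => /andP[/FP[vj vc] /eqP vc'].
  by exists v.
have [col2 h2] := fin_all_exists stage2.
apply: (@equitable_of_map _ _ _ _ (fun v => (col1 v, col2 (col1 v) v))) => //.
  move=> e [c c'] eE; have [v ve [vc vc']] := (h2 c).2 (exist _ e eE) c'.
  by exists v => //; rewrite vc vc'.
move=> [c c'].
have -> : #|[set v | (col1 v, col2 (col1 v) v) == (c, c')]|
        = hits [set v | col1 v == c] (col2 c) c'.
  apply: eq_card => v; rewrite !inE xpair_eqE.
  by case: eqP => // ->.
have /andP[lo1 hi1] := size1 c; have /andP[lo2 hi2] := (h2 c).1 c'.
have nE : hits [set: V] col1 c = #|[set v | col1 v == c]|.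
  by apply: eq_card => v; rewrite !inE.
rewrite nE cardsT in lo1 hi1; apply/andP; split.
  by rewrite divnMA (leq_trans _ lo2) // leq_div2r.
by rewrite -ceil_divnM (leq_trans hi2) // leq_ceil_divn.
Qed.

(** * The greedy construction of hypergraphs without small transversals *)

(* Candidate transversals of size at most tau are the images of functions from
   'I_tau, so that there are #|V| ^ tau of them to start with. *)
Definition transversals (V : finType) (tau : nat) (E : {set {set V}}) :
    {set {ffun 'I_tau -> V}} :=
  [set f : {ffun 'I_tau -> V} | [forall e in E, e :&: f @: 'I_tau != set0]].

Lemma sum_degree (V : finType) (k : nat) (E : {set {set V}}) :
  uniform k E -> (\sum_v degree E v = #|E| * k)%N.
Proof.
move=> /forall_inP unif.
rewrite (eq_bigr (fun v => \sum_(e in E) (v \in e : nat))%N); last first.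
  move=> v _; rewrite /degree -sum1_card big_mkcond [RHS]big_mkcond /=.
  by apply: eq_bigr => e _; rewrite inE; case: (e \in E); case: (v \in e).
rewrite exchange_big /= -sum_nat_const; apply: eq_bigr => e eE.
by rewrite -(eqP (unif e eE)) -sum1_card [RHS]big_mkcond; apply: eq_bigr => v _; case: ifP.
Qed.

Lemma degreeU1 (V : finType) (E : {set {set V}}) (e : {set V}) (v : V) :
  (degree (e |: E) v <= (v \in e) + degree E v)%N.
Proof.
have sub : [set e' in e |: E | v \in e']
    \subset [set e' in [set e] | v \in e'] :|: [set e' in E | v \in e'].
  by apply/subsetP => e'; rewrite !inE => /andP[/orP[]-> ->]; rewrite ?orbT.
apply: leq_trans (subset_leq_card sub) _.
apply: leq_trans (leq_card_setU _ _) _; rewrite leq_add2r.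
case ve: (v \in e).
  rewrite -[X in (_ <= X)%N](cards1 e); apply: subset_leq_card.
  by apply/subsetP => e'; rewrite !inE => /andP[].
rewrite leqn0 cards_eq0; apply/eqP/setP => e'; rewrite !inE.
by case: eqP => // ->; rewrite ve.
Qed.

(* Averaging over the k-subsets of W. *)
Lemma exists_avoiding_edge (R : realType) (V : finType) (k tau : nat)
    (W : {set V}) (F : {set {ffun 'I_tau -> V}}) (p : R) :
  (k <= #|W|)%N -> p * 'C(#|W|, k)%:R <= 'C(#|W| - tau, k)%:R ->
  exists e : {set V}, [/\ e \subset W, #|e| = k &
    p * #|F|%:R <= #|[set f in F | e :&: f @: 'I_tau == set0]|%:R].
Proof.
move=> kW hp.
pose Q := [set e : {set V} | e \subset W & #|e| == k].
have cQ : #|Q| = 'C(#|W|, k) by apply: cards_draws.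
(* Double counting: the image of [f] has at most [tau] points, so at least ['C(#|W| - tau, k)] of
   the [k]-subsets of [W] avoid it. *)
have dcount : (#|F| * 'C(#|W| - tau, k)
    <= \sum_(e in Q) #|[set f in F | e :&: f @: 'I_tau == set0]|)%N.
  rewrite (eq_bigr (fun e : {set V} => \sum_(f in F) (e :&: f @: 'I_tau == set0 : nat))%N);
    last first.
    move=> e _; rewrite -sum1_card big_mkcond [RHS]big_mkcond /=.
    by apply: eq_bigr => f _; rewrite inE; case: (f \in F); case: (_ == set0).
  rewrite exchange_big /= -sum_nat_const; apply: leq_sum => f _.
  have -> : (\sum_(e in Q) (e :&: f @: 'I_tau == set0 : nat) =
      #|[set e : {set V} | e \subset W :\: f @: 'I_tau & #|e| == k]|)%N.
    rewrite -sum1_card big_mkcond [RHS]big_mkcond /=; apply: eq_bigr => e _.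
    rewrite !inE setDE subsetI -disjoints_subset -setI_eq0.
    by case: (e \subset W); case: (#|e| == k); case: (_ == set0).
  rewrite cards_draws; apply: leq_bin2l; rewrite cardsD leq_sub2l //.
  apply: leq_trans (subset_leq_card (subsetIr _ _)) _.
  by apply: leq_trans (leq_imset_card _ _) _; rewrite card_ord.
have Q0 : (0 < #|Q|)%N by rewrite cQ bin_gt0.
have [/exists_inP[e]|] := boolP [exists e in Q,
    p * #|F|%:R <= #|[set f in F | e :&: f @: 'I_tau == set0]|%:R :> R].
  by rewrite inE => /andP[eW /eqP ek] he; exists e.
rewrite negb_exists_in => /forall_inP none.
have : (\sum_(e in Q) #|[set f in F | e :&: f @: 'I_tau == set0]|)%:R
       < \sum_(e in Q) p * #|F|%:R :> R.
  rewrite natr_sum; apply: ltr_sum => [|e /none]; last by rewrite -ltNge.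
  by have [e eQ] := card_gt0P Q0; apply/hasP; exists e => //; rewrite mem_index_enum.
rewrite sumr_const cQ -[X in _ < X]mulr_natr mulrAC ltNge => /negP[].
apply: le_trans (ler_wpM2r (ler0n _ _) hp) _.
by rewrite -natrM ler_nat mulnC.
Qed.

(* w0 bounds from below the number of vertices of degree less than D during the
   first M steps. *)
Lemma greedy_edges (R : realType) (V : finType) (k tau D M w0 : nat) (p : R) :
  (0 < D)%N -> (k <= w0)%N -> (w0 <= #|V|)%N -> (M * k <= (#|V| - w0) * D)%N ->
  (forall w, (w0 <= w)%N -> p * 'C(w, k)%:R <= 'C(w - tau, k)%:R) ->
  p <= 1 ->
  forall j, (j <= M)%N -> exists E : {set {set V}},
    [/\ uniform k E, forall v, (degree E v <= D)%N, (#|E| <= j)%N &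
      #|transversals tau E|%:R <= (1 - p) ^+ j * (#|V| ^ tau)%:R].
Proof.
move=> D0 kw0 w0V MD hp p1; elim=> [|j IHj] jM.
  exists set0; split.
  - by apply/forall_inP => e; rewrite inE.
  - by move=> v; rewrite /degree eq_card0 // => e; rewrite !inE.
  - by rewrite cards0.
  - rewrite expr0 mul1r ler_nat (leq_trans (max_card _)) //.
    by rewrite card_ffun card_ord.
have [E [unif degE cE aE]] := IHj (ltnW jM).
pose W := [set v | degree E v < D]%N.
(* Each saturated vertex uses up [D] of a total degree of at most [M * k], so at most [#|V| - w0]
   vertices are saturated. *)
have w0W : (w0 <= #|W|)%N.
  have full : (#|~: W| * D <= (#|V| - w0) * D)%N.
    apply: leq_trans MD; apply: (@leq_trans (#|E| * k)); last first.
      by rewrite leq_mul2r (leq_trans cE (ltnW jM)) orbT.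
    rewrite -(sum_degree unif) -sum_nat_const.
    rewrite [leqRHS](bigID [in ~: W]) /=; apply: leq_trans (leq_addr _ _).
    by apply: leq_sum => v; rewrite !inE -leqNgt.
  by rewrite leq_pmul2r // in full; have := cardsC W; lia.
have [e [eW ek he]] := exists_avoiding_edge (transversals tau E) (leq_trans kw0 w0W) (hp _ w0W).
exists (e |: E); split.
- apply/forall_inP => e'; rewrite !inE => /orP[/eqP->|]; first by rewrite ek.
  by apply: (forall_inP unif).
- move=> v; apply: leq_trans (degreeU1 _ _ _) _.
  case ve: (v \in e); last exact: degE.
  by have := subsetP eW v ve; rewrite inE.
- by apply: leq_trans (leq_card_setU _ _) _; rewrite cards1 add1n ltnS.
- have -> : transversals tau (e |: E) = transversals tau E
      :\: [set f in transversals tau E | e :&: f @: 'I_tau == set0].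
    apply/setP => f; rewrite !inE.
    apply/forall_inP/andP => [h|[h1 /forall_inP h2] e'].
      split; last by apply/forall_inP => e' e'E; apply: h; rewrite !inE e'E orbT.
      by rewrite negb_and (h e) ?orbT // !inE eqxx.
    rewrite !inE => /orP[/eqP->|/h2//].
    move: h1; rewrite negb_and => /orP[|//] /negP[].
    by apply/forall_inP => ? /h2.
  rewrite cardsD (setIidPr _); last by apply/subsetP => f; rewrite inE => /andP[].
  rewrite natrB; last first.
    by apply: subset_leq_card; apply/subsetP => f; rewrite inE => /andP[].
  rewrite exprS -mulrA; apply: le_trans (ler_wpM2l _ aE); last by rewrite subr_ge0.
  by rewrite mulrBl mul1r lerD2l lerN2.
Qed.

(** Each part of a strong coloring is a transversal, so without transversals of size at most [tau]
    every part has at least [tau.+1] vertices. *)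
Lemma strong_coloring_number_le (V : finType) (tau : nat) (E : {set {set V}}) :
  transversals tau E = set0 -> (strong_coloring_number E * tau.+1 <= #|V|)%N.
Proof.
move=> noT; rewrite -leq_divRL // /strong_coloring_number.
apply/bigmax_leqP => P /andP[Ppart /forall_inP hit].
rewrite leq_divRL // -[#|V|]cardsT (card_partition Ppart) -sum_nat_const.
apply: leq_sum => q qP; rewrite ltnNge; apply/negP => qtau.
have [v0 v0q] : exists v, v \in q.
  by apply/set0Pn; apply: contraTneq qP => ->; case/and3P: Ppart.
(* The default [v0], itself in [q], fills the indices beyond [#|q|]. *)
have : [ffun i : 'I_tau => nth v0 (enum q) i] \in transversals tau E.
  rewrite inE; apply/forall_inP => e /hit /forall_inP /(_ q qP) /set0Pn[v].
  rewrite inE => /andP[ve vq]; apply/set0Pn; exists v; rewrite inE ve /=.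
  have lt : (index v (enum q) < tau)%N.
    by apply: leq_trans qtau; rewrite cardE index_mem mem_enum.
  by apply/imsetP; exists (Ordinal lt); rewrite // ffunE nth_index // mem_enum.
by rewrite noT inE.
Qed.

(** After [M] greedy steps the number of transversals is below 1, hence 0. In particular [E] has an
    edge, since with no edges every function would count as a transversal. *)
Lemma exists_hard_hypergraph (R : realType) (V : finType) (k tau D M w0 : nat) (p : R) :
  (0 < D)%N -> (k <= w0)%N -> (0 < w0)%N -> (w0 <= #|V|)%N ->
  (M * k <= (#|V| - w0) * D)%N ->
  (forall w, (w0 <= w)%N -> p * 'C(w, k)%:R <= 'C(w - tau, k)%:R) ->
  p <= 1 -> (1 - p) ^+ M * (#|V| ^ tau)%:R < 1 ->
  exists E : {set {set V}}, [/\ E != set0, uniform k E, (max_degree E <= D)%N &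
    (strong_coloring_number E * tau.+1 <= #|V|)%N].
Proof.
move=> D0 kw0 w00 w0V MD hp p1 small.
have [E [unif degE _ aE]] := greedy_edges D0 kw0 w0V MD hp p1 (leqnn M).
have noT : transversals tau E = set0.
  apply/eqP; rewrite -cards_eq0 -leqn0 -ltnS -(ltr_nat R).
  exact: le_lt_trans aE small.
exists E; split => //.
- have [v _] : exists v, v \in [set: V].
    by apply/card_gt0P; rewrite cardsT (leq_trans w00).
  apply/eqP => E0; have := in_set0 [ffun _ : 'I_tau => v].
  by rewrite -noT inE E0; move/negP; apply; apply/forall_inP => e; rewrite inE.
- by rewrite /max_degree; apply/bigmax_leqP => v _.
- exact: strong_coloring_number_le.
Qed.

(** * Elementary estimates *)

(** The ratio of the binomials is the product over [i < k] of [(w - tau - i) / (w - i)], which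
    decreases in [i]; each factor is compared with its value at [i = k], after
    cross-multiplication. *)
Lemma bin_sub_ge (w k tau : nat) :
  ('C(w, k) * (w - tau - k) ^ k <= 'C(w - tau, k) * (w - k) ^ k)%N.
Proof.
rewrite -(leq_pmul2r (fact_gt0 k)) mulnAC bin_ffact [leqRHS]mulnAC bin_ffact.
have powE x : (x ^ k = \prod_(i < k) x)%N by rewrite prod_nat_const card_ord.
rewrite !ffact_prod !powE -!big_split /=; apply: leq_prod => i _.
have := ltn_ord i; have [->|] := posnP (w - tau - k)%N; first by rewrite muln0.
move: (nat_of_ord i) => j h lt.
have [u wE] : exists u, (w = u + tau + k)%N by exists (w - tau - k)%N; lia.
have [l kE] : exists l, (k = j + l)%N by exists (k - j)%N; lia.
have -> : (w - j = u + tau + l)%N by lia.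
have -> : (w - tau - k = u)%N by lia.
have -> : (w - tau - j = u + l)%N by lia.
have -> : (w - k = u + tau)%N by lia.
nia.
Qed.

(** The Taylor term of degree [n.+1] alone exceeds the left side once [L] passes the chosen
    threshold. *)
Lemma pow_le_expR (R : realType) (n : nat) (C d : R) : 0 < d ->
  exists L0 : R, forall L, L0 <= L -> C * L ^+ n <= expR (d * L).
Proof.
move=> d0; exists (`|C| * n.+1`!%:R / d ^+ n.+1) => L leL.
have dn0 : 0 < d ^+ n.+1 by apply: exprn_gt0.
have f0 : 0 < n.+1`!%:R :> R by rewrite ltr0n fact_gt0.
have L0 : 0 <= L.
  by apply: le_trans leL; rewrite mulr_ge0 ?invr_ge0 ?(ltW dn0) // mulr_ge0 ?(ltW f0).
apply: le_trans (le_trans _ (expR_ge1Dxn n (mulr_ge0 (ltW d0) L0))).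
  apply: ler_wpM2r; [exact: exprn_ge0|exact: ler_norm].
apply: (@le_trans _ _ ((d * L) ^+ n.+1 / n.+1`!%:R)); last by rewrite lerDr.
have -> : (d * L) ^+ n.+1 / n.+1`!%:R = d ^+ n.+1 * L / n.+1`!%:R * L ^+ n.
  by rewrite exprMn [L ^+ n.+1]exprS; ring.
rewrite ler_wpM2r ?exprn_ge0 // ler_pdivlMr //.
by move: leL; rewrite ler_pdivrMr // [L * _]mulrC.
Qed.

Lemma ln_natr_large (R : realType) (B : R) :
  exists k0, forall k, (k0 <= k)%N -> (0 < k)%N /\ B <= ln (k%:R : R).
Proof.
exists (Num.bound (expR B)) => k kk.
have h : expR B < k%:R.
  apply: lt_le_trans (archi_boundP (expR_ge0 B)) _; by rewrite ler_nat.
have k0 : 0 < k%:R :> R := lt_trans (expR_gt0 B) h.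
split; first by rewrite ltr0n in k0.
by rewrite -ler_expR lnK ?posrE // ltW.
Qed.

(** Rounding down loses at most 1, which is at most [d * x]; integer parameters can thus be treated
    as reals up to a factor [1 - d]. *)
Lemma truncn_near (R : realType) (d x : R) :
  0 < d -> d < 1 -> d^-1 <= x ->
  [/\ (1 - d) * x <= (Num.truncn x)%:R, (Num.truncn x)%:R <= x & (0 < Num.truncn x)%N].
Proof.
move=> d0 d1 dx.
have x0 : 0 <= x by apply: le_trans dx; rewrite invr_ge0 ltW.
have /andP[lo hi] := truncn_itv x0.
have dx1 : 1 <= d * x by rewrite -ler_pdivrMl // mulr1.
have x1 : 1 <= x by apply: le_trans dx1 _; rewrite ler_piMl // ltW.
rewrite -natr1 in hi; split => //; first by rewrite mulrBl mul1r; lra.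
by rewrite -(ltr_nat R); lra.
Qed.

(** The reciprocal of [1 + y <= expR y] at [y = x / (1 - x)]. *)
Lemma onem_ge_expR (R : realType) (x : R) : x < 1 -> expR (- (x / (1 - x))) <= 1 - x.
Proof.
move=> x1; have y0 : 0 < 1 - x by rewrite subr_gt0.
rewrite expRN -[leRHS]invrK lef_pV2 ?posrE ?invr_gt0 ?expR_gt0 //.
have e : (1 - x)^-1 = 1 + x / (1 - x) :> R by field; rewrite gt_eqF.
rewrite [leLHS]e; exact: expR_ge1Dx.
Qed.

(** * Parameters and asymptotics for part (i) *)

Lemma coloring_parameters (R : realType) (a d : R) : 1 <= a -> 0 < d -> d <= 8^-1 ->
  exists L0 : R, forall k, (0 < k)%N -> L0 <= ln (k%:R : R) ->
    exists s t m : nat, [/\ (0 < m)%N,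
      forall Dg, Dg%:R <= k%:R `^ a ->
        (4 * (k * s.+1 * s.+1 * Dg))%:R * expR (- (k%:R / s.+1%:R * d))
          <= (1 - d) ^+ m.-1,
      forall Dg, Dg%:R <= k%:R `^ a ->
        (4 * (m * t.+1 * t.+1 * Dg))%:R * expR (- (m%:R / t.+1%:R)) <= 1 :> R &
      (1 - 6 * d) * (k%:R / (a * ln k%:R)) <= (s.+1 * t.+1)%:R].
Proof.
move=> a1 d0 d8.
have [L1 hL1] := @pow_le_expR R 2 d^-1 1 ltr01.
have [L2 hL2] := @pow_le_expR R 6 4 d d0.
(* [L1] and [4 * a / d] make the rounded quantities large, [(7 + a) / d ^+ 2] serves the first local
   lemma condition and [L2] the second. *)
exists (Num.max 1 (Num.max L1 (Num.max L2 (Num.max (4 * a / d) ((7 + a) / d ^+ 2))))).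
move=> k k0; set L := ln _; rewrite !ge_max => /and5P[gt1 /hL1 e1 /hL2 e2 e3 e4].
have K0 : 0 < k%:R :> R by rewrite ltr0n.
have KE : k%:R = expR L by rewrite lnK.
have KaE : k%:R `^ a = expR (a * L) by rewrite mulrC expRM -KE.
rewrite mul1r -KE in e1.
have d1 : d < 1 by lra.
have Lp : 0 < L by lra.
have a0 : 0 < a by lra.
have L20 : 0 < L ^+ 2 by apply: exprn_gt0.
have e3' : 4 * a <= d * L by rewrite -ler_pdivrMl // mulrC.
have e4' : 7 + a <= d ^+ 2 * L by rewrite -ler_pdivrMl ?exprn_gt0 // mulrC.
have LL2 : L <= L ^+ 2 by rewrite expr2 ler_peMl // ltW.
have [|lo_s hi_s s0] := @truncn_near R d (k%:R / L ^+ 2) d0 d1.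
  by rewrite ler_pdivlMr.
set s := Num.truncn _ in lo_s hi_s s0.
have [|lo_m hi_m m0] := @truncn_near R d ((1 - d) ^+ 2 * L ^+ 2) d0 d1.
  have h1 : 2^-1 <= (1 - d) ^+ 2 by nra.
  have h2 : 4 <= d * L by lra.
  rewrite -[leLHS]mulr1 ler_pdivrMl // mulrA; nra.
set m := Num.truncn _ in lo_m hi_m m0.
have m_ge : 2^-1 * L ^+ 2 <= m%:R.
  have h : 2^-1 <= (1 - d) ^+ 3 by have := mulr_ge0 (ltW d0) (ltW d0); nra.
  apply: le_trans lo_m; rewrite mulrA -exprS ler_wpM2r //; exact: ltW.
have da0 : 0 < (1 + d) * a * L by rewrite !mulr_gt0 // addr_gt0.
have [|lo_t hi_t t0] := @truncn_near R d (m%:R / ((1 + d) * a * L)) d0 d1.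
  rewrite ler_pdivlMr // ler_pdivrMl //; apply: le_trans (ler_wpM2l (ltW d0) m_ge).
  nra.
set t := Num.truncn _ in lo_t hi_t t0.
have sp : 0 < s%:R :> R by rewrite ltr0n.
have tp : 0 < t%:R :> R by rewrite ltr0n.
have L21 : 1 <= L ^+ 2 by exact: le_trans LL2.
have m_le : m%:R <= L ^+ 2.
  apply: le_trans hi_m _; rewrite ler_piMl ?(ltW L20) // exprn_ile1 //; lra.
have den1 : 1 <= (1 + d) * a * L.
  have h : 1 <= (1 + d) * a by rewrite -[leLHS]mulr1 ler_pM //; lra.
  by rewrite -[leLHS]mulr1 ler_pM.
exists s.-1, t.-1, m; rewrite !prednK //; split => // [Dg|Dg|].
- rewrite KaE => DgE.
  have sK : s%:R <= expR L.
    by rewrite -KE; apply: le_trans hi_s _; rewrite ler_pdivrMr // ler_peMr // ltW.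
  have four : 4 <= expR (4 * L) by apply: le_trans (expR_ge1Dx _); lra.
  have ks : L ^+ 2 <= k%:R / s%:R.
    by rewrite ler_pdivlMr // mulrC -ler_pdivlMr.
  (* The exponent collects [4 * L] for the constant 4, [L] for each of [k], [s], [s], and [a * L]
     for the degree. *)
  apply: (@le_trans _ _ (expR ((7 + a) * L) * expR (- (L ^+ 2 * d)))).
    apply: ler_pM; rewrite ?ler0n ?expR_ge0 //; last first.
      by rewrite ler_expR lerN2 ler_wpM2r // ltW.
    have -> : (7 + a) * L = 4 * L + (L + L + L + a * L) by ring.
    rewrite !expRD !natrM ler_pM ?mulr_ge0 ?ler0n //.
    by rewrite !ler_pM ?mulr_ge0 ?ler0n // KE.
  rewrite -expRD; apply: (@le_trans _ _ ((1 - d) ^+ m)); last first.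
    by apply: ler_wiXn2l; rewrite ?leq_pred //; lra.
  apply: le_trans (lerXn2r _ _ _ (onem_ge_expR d1)); rewrite ?nnegrE ?expR_ge0 //;
    last by lra.
  rewrite -expRM_natl ler_expR mulrN lerNr opprB.
  have d1' : 0 < 1 - d by lra.
  (* As [m <= (1 - d) ^+ 2 * L ^+ 2], the right side costs only [(1 - d) * d * L ^+ 2] in the
     exponent; the remaining [d ^+ 2 * L ^+ 2] absorbs [(7 + a) * L]. *)
  apply: (@le_trans _ _ ((1 - d) ^+ 2 * L ^+ 2 * (d / (1 - d)))).
    by rewrite ler_wpM2r // divr_ge0 // ltW.
  have -> : (1 - d) ^+ 2 * L ^+ 2 * (d / (1 - d)) = (1 - d) * d * L ^+ 2.
    by field; rewrite gt_eqF.
  have : (7 + a) * L <= d ^+ 2 * L * L by rewrite ler_wpM2r // ltW.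
  rewrite -mulrA -expr2; lra.
- rewrite KaE => DgE.
  have tm : t%:R <= m%:R :> R.
    by apply: le_trans hi_t _; rewrite ler_pdivrMr ?ler_peMr.
  have t_le : t%:R <= L ^+ 2 := le_trans tm m_le.
  have mt : (1 + d) * a * L <= m%:R / t%:R.
    by rewrite ler_pdivlMr // mulrC -ler_pdivlMr.
  (* The polynomial factor is at most [4 * L ^+ 6 <= expR (d * L)], paid for by the extra [1 + d] in
     the definition of [t], because [1 <= a]. *)
  apply: (@le_trans _ _ (expR (d * L + a * L) * expR (- ((1 + d) * a * L)))).
    apply: ler_pM; rewrite ?ler0n ?expR_ge0 //; last by rewrite ler_expR lerN2.
    rewrite expRD; apply: le_trans (ler_wpM2r (expR_ge0 _) e2).
    have -> : 4 * L ^+ 6 = 4 * (L ^+ 2 * L ^+ 2 * L ^+ 2) by ring.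
    rewrite !natrM -[leRHS]mulrA ler_wpM2l // ler_pM ?mulr_ge0 ?ler0n //.
    by rewrite !ler_pM ?mulr_ge0 ?ler0n.
  rewrite -expRD expR_le1.
  have : d * L <= a * (d * L) by rewrite ler_peMl // mulr_ge0 ?ltW.
  by lra.
- rewrite natrM.
  (* The roundings and margins lose [(1 - d) ^+ 5 / (1 + d)] altogether, which is at least
     [1 - 6 * d]. *)
  apply: (@le_trans _ _ (((1 - d) * (k%:R / L ^+ 2)) *
      ((1 - d) * ((1 - d) * ((1 - d) ^+ 2 * L ^+ 2) / ((1 + d) * a * L))))).
    have -> : (1 - d) * (k%:R / L ^+ 2) *
      ((1 - d) * ((1 - d) * ((1 - d) ^+ 2 * L ^+ 2) / ((1 + d) * a * L)))
      = (1 - d) ^+ 5 / (1 + d) * (k%:R / (a * L)).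
      by field; rewrite !gt_eqF //; lra.
    have X0 : 0 <= k%:R / (a * L) by rewrite divr_ge0 ?ler0n // mulr_ge0 // ltW.
    rewrite ler_wpM2r // ler_pdivlMr; last by lra.
    have b2 : 1 - 2 * d <= (1 - d) ^+ 2 by nra.
    have b4 : 1 - 4 * d <= (1 - d) ^+ 4.
      have -> : (1 - d) ^+ 4 = (1 - d) ^+ 2 * (1 - d) ^+ 2 by ring.
      by nra.
    by rewrite exprS; nra.
  apply: ler_pM => //.
  - by rewrite mulr_ge0 ?divr_ge0 ?ler0n ?ltW //; lra.
  - by rewrite !(mulr_ge0, divr_ge0) ?exprn_ge0 ?invr_ge0 ?ltW //; lra.
  - apply: le_trans lo_t; rewrite ler_wpM2l //; first by lra.
    by rewrite ler_wpM2r // invr_ge0 ltW.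
Qed.

Lemma equitable_asymptotics (R : realType) (a : R) : 1 <= a ->
  forall eps : R, 0 < eps ->
    exists k0 : nat, forall k : nat, (k0 <= k)%N ->
      forall (V : finType) (E : {set {set V}}),
        E != set0 -> uniform k E ->
        (max_degree E)%:R <= k%:R `^ a ->
        (1 - eps) * (k%:R / (a * ln k%:R)) <= (equitable_coloring_number E)%:R.
Proof.
move=> a1 eps eps0.
have [d [d0 d8 deps]] : exists d : R, [/\ 0 < d, d <= 8^-1 & 6 * d <= eps].
  exists (Num.min eps 1 / 8); have : 0 < Num.min eps 1 by rewrite lt_min eps0 /=.
  have : Num.min eps 1 <= 1 by rewrite ge_min lexx orbT.
  have : Num.min eps 1 <= eps by rewrite ge_min lexx.
  by move: (Num.min _ _) => u; split; lra.
have [L0 hL0] := coloring_parameters a1 d0 d8.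
have [k0 hk0] := ln_natr_large (Num.max 0 L0).
exists k0 => k /hk0[kp]; rewrite ge_max => /andP[lnk /(hL0 k kp)].
case=> s [t [m [m0 bound1 bound2 lower]]] V E En0 unif deg.
apply: (@le_trans _ _ ((1 - 6 * d) * (k%:R / (a * ln k%:R)))).
  rewrite ler_wpM2r ?divr_ge0 ?mulr_ge0 ?ler0n //; first by lra.
  by rewrite lerD2l lerN2.
apply: le_trans lower _; rewrite ler_nat.
apply: (@equitable_lower_bound R V E k s t m (1 - d)) => //.
- by lra.
- by lra.
- by rewrite opprB addrC subrK; apply: bound1.
- exact: bound2.
Qed.

(** * Parameters and asymptotics for part (ii) *)

Lemma hard_hypergraph_parameters (R : realType) (a d : R) :
  1 <= a -> 0 < d -> d <= 8^-1 ->
  exists L0 : R, forall k, (0 < k)%N -> L0 <= ln (k%:R : R) ->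
    exists tau D M w0 : nat, exists p : R,
      [/\ (0 < D)%N /\ D%:R <= k%:R `^ a,
          [/\ (k <= w0)%N, (0 < w0)%N, (w0 <= k ^ 2)%N &
              (M * k <= (k ^ 2 - w0) * D)%N],
          (forall w, (w0 <= w)%N -> p * 'C(w, k)%:R <= 'C(w - tau, k)%:R) /\ p <= 1,
          (1 - p) ^+ M * ((k ^ 2) ^ tau)%:R < 1 &
          (1 - d) * a * ln (k%:R : R) * k%:R <= tau.+1%:R].
Proof.
move=> a1 d0 d8.
pose h := Num.bound (4 / d).
have hd : 4 / d < h%:R by apply: archi_boundP; rewrite divr_ge0 // ltW.
have h0 : 0 < h%:R :> R by apply: lt_trans hd; rewrite divr_gt0.
have hd' : 4 <= d * h%:R by move: hd; rewrite ltr_pdivrMr // mulrC => /ltW.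
have d20 : 0 < d / 2 by lra.
(* The summand 1 makes the final comparison strict. *)
have [L1 hL1] := @pow_le_expR R 2 (8 * h%:R * a + 1) (d / 2) d20.
have [L2 hL2] := @pow_le_expR R 1 (2 * h%:R * a) 1 ltr01.
exists (Num.max 1 (Num.max L1 (Num.max L2 (2 * h%:R)))).
move=> k k0; set L := ln _; rewrite !ge_max => /and4P[gt1 /hL1 e1 /hL2 e2 e3].
have K0 : 0 < k%:R :> R by rewrite ltr0n.
have KE : k%:R = expR L by rewrite lnK.
have KaE : k%:R `^ a = expR (a * L) by rewrite mulrC expRM -KE.
rewrite mul1r -KE expr1 in e2.
have Lp : 0 < L by lra.
have a0 : 0 < a by lra.
have LK : L <= k%:R by rewrite KE; have := expR_ge1Dx L; lra.
have aL1 : 1 <= a * L by rewrite -[leLHS]mulr1 ler_pM.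
pose T := (1 - d) * a * L * k%:R.
have T0 : 0 <= T by rewrite !mulr_ge0 ?ler0n //; lra.
have /andP[tau_le tau_ge] := truncn_itv T0.
set tau := Num.truncn T in tau_le tau_ge.
have [|||D_ge D_le D0] := @truncn_near R 2^-1 (k%:R `^ a).
- by lra.
- by lra.
- by rewrite invrK KaE; have := expR_ge1Dx (a * L); lra.
set D := Num.truncn _ in D_ge D_le D0.
pose q := (k %/ h)%N.
have h0n : (0 < h)%N by rewrite -(ltr0n R).
have q_le : q%:R * h%:R <= k%:R :> R by rewrite -natrM ler_nat leq_trunc_div.
have q_ge : k%:R <= 2 * (q%:R * h%:R) :> R.
  have : k%:R <= (q.+1 * h)%:R :> R by rewrite ler_nat ltnW // ltn_ceil.
  by rewrite natrM -natr1 mulrDl mul1r; lra.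
have qk : (k * q <= k ^ 2)%N by rewrite -mulnn leq_mul2l leq_div orbT.
pose w0 := (k ^ 2 - k * q)%N.
have w0E : w0%:R = k%:R ^+ 2 - k%:R * q%:R :> R by rewrite natrB // natrX natrM.
(* Saturated vertices take at most a share [d / 4] of the [k ^ 2] vertices, and [k + tau] takes at
   most another [d / 4]. *)
have free : (1 - d / 2) * k%:R ^+ 2 <= w0%:R - k%:R - tau%:R.
  have qd : q%:R <= d / 4 * k%:R :> R.
    have : q%:R * 4 <= q%:R * (d * h%:R) :> R by rewrite ler_wpM2l.
    have : d * (q%:R * h%:R) <= d * k%:R by rewrite ler_wpM2l // ltW.
    by lra.
  have kd : 1 + a * L <= d / 4 * k%:R.
    have : 8 * (a * L) <= d * h%:R * (2 * (a * L)).
      have := ler_wpM2r (_ : 0 <= 2 * (a * L)) hd'; lra.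
    have : d * (2 * h%:R * a * L) <= d * k%:R by rewrite ler_wpM2l // ltW.
    by lra.
  have TaLk : tau%:R <= a * L * k%:R.
    by apply: le_trans tau_le _; rewrite /T -!mulrA ler_piMl ?mulr_ge0 ?ler0n //; lra.
  have := ler_wpM2l (ler0n R k) qd; have := ler_wpM2l (ler0n R k) kd.
  by rewrite w0E expr2; lra.
have K20 : 0 < k%:R ^+ 2 :> R by exact: exprn_gt0.
have free0 : 0 < w0%:R - k%:R - tau%:R :> R.
  by apply: (lt_le_trans _ free); rewrite mulr_gt0 //; lra.
have kw0 : (k + tau < w0)%N by rewrite -(ltr_nat R) natrD; lra.
have w0k : (w0 <= k ^ 2)%N by rewrite leq_subr.
have MD : (q * D * k <= (k ^ 2 - w0) * D)%N.
  by rewrite subKn // [(k * q)%N]mulnC mulnAC.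
clearbody w0 D tau.
pose p := expR (- ((1 - d / 2) * (a * L))).
exists tau, D, (q * D)%N, w0, p; split => //.
- split => //; last exact: leq_ltn_trans kw0.
  by apply: leq_trans (ltnW kw0); rewrite leq_addr.
- split; last by rewrite expR_le1 oppr_le0 mulr_ge0 //; lra.
  move=> w w0w.
  have wk0 : 0 < (w - k)%:R :> R by rewrite ltr0n; clear -kw0 w0w; lia.
  rewrite -(ler_pM2r (exprn_gt0 k wk0)).
  have := bin_sub_ge w k tau; rewrite -(ler_nat R) !natrM !natrX.
  apply: le_trans; rewrite mulrAC [leRHS]mulrC; apply: ler_wpM2r => //.
  have wkt : (w - tau - k)%:R = (w - k)%:R - tau%:R :> R.
    by rewrite -natrB; [congr (_%:R) | ]; clear -kw0 w0w; lia.
  have ww0 : w0%:R - k%:R <= (w - k)%:R :> R.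
    by rewrite -natrB; [rewrite ler_nat | ]; clear -kw0 w0w; lia.
  pose x := tau%:R / (w - k)%:R : R.
  have -> : (w - tau - k)%:R = (w - k)%:R * (1 - x).
    by rewrite wkt /x; field; rewrite gt_eqF.
  rewrite exprMn mulrC ler_wpM2l ?exprn_ge0 ?ler0n //.
  have x1 : x < 1 by rewrite /x ltr_pdivrMr // mul1r; lra.
  apply: (@le_trans _ _ (expR (- (x / (1 - x))) ^+ k)); last first.
    by apply: lerXn2r (onem_ge_expR x1); rewrite ?nnegrE ?expR_ge0 //; lra.
  rewrite -expRM_natl ler_expR mulrN lerN2.
  have -> : x / (1 - x) = tau%:R / ((w - k)%:R - tau%:R).
    by rewrite /x; field; rewrite !gt_eqF //; lra.
  rewrite mulrA ler_pdivrMr; last by lra.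
  (* This rests on [1 - d <= (1 - d / 2) ^+ 2]: one factor is the exponent of [p], the other the
     loss in [free]. *)
  apply: (@le_trans _ _ ((1 - d / 2) * (a * L) * ((1 - d / 2) * k%:R ^+ 2))).
    apply: (@le_trans _ _ (k%:R * T)); first by rewrite ler_wpM2l.
    have -> : k%:R * T = (1 - d) * (a * L * k%:R ^+ 2) by rewrite /T; ring.
    have -> : (1 - d / 2) * (a * L) * ((1 - d / 2) * k%:R ^+ 2)
      = (1 - d / 2) ^+ 2 * (a * L * k%:R ^+ 2) by ring.
    have Y0 : 0 <= a * L * k%:R ^+ 2 by rewrite !mulr_ge0 ?ltW.
    rewrite ler_wpM2r //.
    by have := sqr_ge0 (d / 2); lra.
  by rewrite ler_wpM2l ?mulr_ge0 //; lra.
- have -> : ((k ^ 2) ^ tau)%:R = expR (2 * (tau%:R * L)) :> R.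
    by rewrite !natrX KE -!expRM_natl; congr expR; ring.
  have p1 : 0 <= 1 - p by rewrite subr_ge0 expR_le1 oppr_le0 mulr_ge0 //; lra.
  have pM : (1 - p) ^+ (q * D) <= expR (- ((q * D)%:R * p)).
    apply: (@le_trans _ _ (expR (- p) ^+ (q * D))).
      by apply: lerXn2r (expR_ge1Dx (- p)); rewrite ?nnegrE ?expR_ge0.
    by rewrite -expRM_natl mulrN.
  apply: le_lt_trans (ler_wpM2r (expR_ge0 _) pM) _.
  rewrite -expRD expR_lt1.
  suff : 2 * (tau%:R * L) < (q * D)%:R * p by lra.
  apply: (@le_lt_trans _ _ (2 * a * L ^+ 2 * k%:R)).
    have : tau%:R * L <= T * L by rewrite ler_wpM2r // ltW.
    have : (1 - d) * (a * L * k%:R * L) <= a * L * k%:R * L.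
      by rewrite ler_piMl ?mulr_ge0 ?ler0n //; lra.
    by rewrite /T expr2; lra.
  (* The exponent [M * p] is at least [k / (4 * h)] times [k] to the power [a * d / 2], which beats
     the logarithm of the number of candidates, of order [k * L ^+ 2]. *)
  apply: (@lt_le_trans _ _ (k%:R / (2 * h%:R) * (2^-1 * k%:R `^ a) * p)); last first.
    rewrite ler_wpM2r ?expR_ge0 // natrM ler_pM //.
    - by rewrite divr_ge0 ?mulr_ge0 ?ler0n.
    - by rewrite mulr_ge0 ?powR_ge0 ?invr_ge0.
    - by rewrite ler_pdivrMr ?mulr_gt0 //; lra.
    - apply: le_trans D_ge; rewrite ler_wpM2r ?powR_ge0 //; lra.
  have -> : k%:R / (2 * h%:R) * (2^-1 * k%:R `^ a) * p
    = k%:R / (4 * h%:R) * expR (d / 2 * L * a).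
    have -> : d / 2 * L * a = a * L + (- ((1 - d / 2) * (a * L))) by lra.
    by rewrite expRD -/p -KaE; field; rewrite gt_eqF.
  rewrite [ltRHS]mulrAC ltr_pdivlMr ?mulr_gt0 //.
  rewrite [ltRHS]mulrC -[ltLHS]mulrA [k%:R * _]mulrC mulrA ltr_pM2r //.
  apply: (@lt_le_trans _ _ ((8 * h%:R * a + 1) * L ^+ 2)).
    have : 0 < L ^+ 2 by apply: exprn_gt0.
    by lra.
  apply: le_trans e1 _; rewrite ler_expR ler_peMr //.
  by rewrite mulr_ge0 // ltW.
- exact: ltW.
Qed.

Lemma hard_hypergraph_asymptotics (R : realType) (a : R) : 1 <= a ->
  forall eps : R, 0 < eps ->
    exists k0 : nat, forall k : nat, (k0 <= k)%N ->
      exists (V : finType) (E : {set {set V}}),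
        [/\ E != set0, uniform k E,
            (max_degree E)%:R <= k%:R `^ a &
            (strong_coloring_number E)%:R
              <= (1 + eps) * (k%:R / (a * ln k%:R))].
Proof.
move=> a1 eps eps0.
have [d [d0 d8 deps]] : exists d : R, [/\ 0 < d, d <= 8^-1 & 2 * d <= eps].
  exists (Num.min eps 1 / 8); have : 0 < Num.min eps 1 by rewrite lt_min eps0 /=.
  have : Num.min eps 1 <= 1 by rewrite ge_min lexx orbT.
  have : Num.min eps 1 <= eps by rewrite ge_min lexx.
  by move: (Num.min _ _) => u; split; lra.
have [L0 hL0] := hard_hypergraph_parameters a1 d0 d8.
have [k0 hk0] := ln_natr_large (Num.max 1 L0).
exists k0 => k /hk0[kp]; rewrite ge_max => /andP[lnk /(hL0 k kp)].
case=> tau [D [M [w0 [p [[D0 D_le] [kw0 w00 w0k MD] [hp p1] small tau_ge]]]]].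
have cV : #|{: 'I_(k ^ 2)}| = (k ^ 2)%N by rewrite card_ord.
have [|||E [En0 unif deg scn]] :=
    @exists_hard_hypergraph R 'I_(k ^ 2) k tau D M w0 p D0 kw0 w00 _ _ hp p1.
- by rewrite cV.
- by rewrite cV.
- by rewrite cV.
exists 'I_(k ^ 2), E; split => //.
  by apply: le_trans D_le; rewrite ler_nat.
have K0 : 0 < k%:R :> R by rewrite ltr0n.
rewrite cV -(ler_nat R) natrM natrX in scn.
move: lnk tau_ge; set L := ln _ => lnk tau_ge.
have aL0 : 0 < a * L by rewrite mulr_gt0 //; lra.
set r := (strong_coloring_number E)%:R in scn *.
have r0 : 0 <= r :> R by rewrite ler0n.
have : r * ((1 - d) * a * L) <= k%:R.
  rewrite -(ler_pM2r K0) -mulrA -expr2; apply: le_trans scn.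
  by rewrite ler_wpM2l.
move=> hr; rewrite mulrA ler_pdivlMr //.
(* From [2 * d <= eps] and [d <= 8^-1]; this absorbs the factor [1 - d] in the size of the color
   classes. *)
have h1 : 1 <= (1 + eps) * (1 - d).
  have : 0 <= d * (8^-1 - d) by rewrite mulr_ge0 ?subr_ge0 // ltW.
  have : 0 <= (eps - 2 * d) * (1 - d) by rewrite mulr_ge0 //; lra.
  by lra.
apply: (@le_trans _ _ ((1 + eps) * (r * ((1 - d) * a * L)))); last first.
  by rewrite ler_wpM2l //; lra.
have -> : (1 + eps) * (r * ((1 - d) * a * L)) = (1 + eps) * (1 - d) * (r * (a * L)).
  by ring.
by rewrite ler_peMl // mulr_ge0 // ltW.
Qed.

Theorem theorem1 (R : realType) (a : R) (ha : 1 <= a) :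
  (forall eps : R, 0 < eps ->
    exists k0 : nat, forall k : nat, (k0 <= k)%N ->
      forall (V : finType) (E : {set {set V}}),
        E != set0 -> uniform k E ->
        (max_degree E)%:R <= k%:R `^ a ->
        (1 - eps) * (k%:R / (a * ln k%:R)) <= (equitable_coloring_number E)%:R)
  /\
  (forall eps : R, 0 < eps ->
    exists k0 : nat, forall k : nat, (k0 <= k)%N ->
      exists (V : finType) (E : {set {set V}}),
        [/\ E != set0, uniform k E,
            (max_degree E)%:R <= k%:R `^ a &
            (strong_coloring_number E)%:R
              <= (1 + eps) * (k%:R / (a * ln k%:R))]).
Proof.
by split; [exact: equitable_asymptotics | exact: hard_hypergraph_asymptotics].
Qed.
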